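(* Let $d\geq 1$ and let $f:\mathbb{R}^d\to\mathbb{R}$ be a Lebesgue measurable componentwise subadditive function. Then $f$ is bounded (from above and from below) in every compact subset of $\mathbb{R}^d$.
   Context: $\mathbb{R}$ is considered as an additive group. A function $g$ on an additive semigroup $S$ is subadditive if $g(x+y)\leq g(x)+g(y)$ for all $x,y\in S$. A function $f$ on a product $S_1\times\cdots\times S_d$ of semigroups is componentwise subadditive if, for every $i\in\{1,\ldots,d\}$ and every fixed choice of $x_j\in S_j$ for all $j\neq i$, the function $x_i\mapsto f(x_1,\ldots,x_i,\ldots,x_d)$ is subadditive on $S_i$. *)

(* Defs.v *)
From mathcomp Require Import all_boot all_order all_algebra.
From mathcomp Require Import all_classical all_reals all_analysis.

Set Implicit Arguments.
Unset Strict Implicit.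
Unset Printing Implicit Defensive.

Import Order.TTheory GRing.Theory Num.Theory.
Import numFieldNormedType.Exports.

Local Open Scope classical_set_scope.
Local Open Scope ring_scope.

Definition subadditive_fun (S : addSemigroupType) (R : numDomainType)
    (g : S -> R) : Prop :=
  forall x y : S, g (x + y) <= g x + g y.

(* [row_upd x i t] is [x] with its [i]-th coordinate replaced by [t]. *)
Definition row_upd (R : Type) (d : nat) (x : 'rV[R]_d) (i : 'I_d) (t : R) :
    'rV[R]_d :=
  \row_(j < d) (if j == i then t else x ord0 j).

Definition componentwise_subadditive (R : numDomainType) (d : nat)
    (f : 'rV[R]_d -> R) : Prop :=
  forall (i : 'I_d) (x : 'rV[R]_d), subadditive_fun (fun t : R => f (row_upd x i t)).

Definition open_box (R : numDomainType) (d : nat) (a b : 'rV[R]_d) :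
    set 'rV[R]_d :=
  [set x | forall i : 'I_d, a ord0 i < x ord0 i < b ord0 i].

Definition box_volume (R : numDomainType) (d : nat) (a b : 'rV[R]_d) : R :=
  \prod_(i < d) (b ord0 i - a ord0 i).

(* Meaningful for [0 < d] only: the covering boxes may be degenerate, hence
   empty and of volume 0, except when [d = 0]. *)
Definition lebesgue_outer_measure (R : realType) (d : nat)
    (A : set 'rV[R]_d) : \bar R :=
  ereal_inf [set v | exists a b : nat -> 'rV[R]_d,
    [/\ forall k (i : 'I_d), a k ord0 i <= b k ord0 i,
        A `<=` \bigcup_k open_box (a k) (b k) &
        v = (\sum_(0 <= k <oo) (box_volume (a k) (b k))%:E)%E]].

Definition lebesgue_measurable_set (R : realType) (d : nat)
    (A : set 'rV[R]_d) : Prop :=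
  (@lebesgue_outer_measure R d).-caratheodory A.

(* On the codomain, [measurable] is the Borel sigma-algebra of [R]. *)
Definition lebesgue_measurable_fun (R : realType) (d : nat)
    (f : 'rV[R]_d -> R) : Prop :=
  forall B : set R, measurable B -> lebesgue_measurable_set (f @^-1` B).

(* Main.v *)
Require Import Defs.
From HB Require Import structures.
From mathcomp Require Import all_boot all_order all_algebra.
From mathcomp Require Import all_classical all_reals all_analysis measurable_realfun.
From mathcomp Require Import ring lra.
Import Order.TTheory GRing.Theory Num.Theory.
Import numFieldNormedType.Exports.
Local Open Scope classical_set_scope.
Local Open Scope ring_scope.

(** Boundedness from below follows from boundedness from above: in each
    coordinate f(0) <= f(t) + f(-t), so on a cube where f <= B, setting one
    coordinate to 0 increases f by at most B, and doing so in all d coordinates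
    leads to the value of f at the origin
    ([componentwise_subadditive_lbound]).

    For the upper bound on a cube Q, split every coordinate of x in Q as
    x_j = y_j + (x_j - y_j), with y in Q. Componentwise subadditivity bounds
    f(x) by the sum of 2^d values of f at points whose j-th coordinate is y_j or
    x_j - y_j, so one of these values is at least f(x) / 2^d
    ([componentwise_subadditive_reflection]). For fixed x and a fixed choice of
    coordinates, y is sent to such a point by a translation composed with
    coordinate reflections, which preserves outer measure. Hence if
    f(x) > 2^d n for some x in Q, then Q is covered by 2^d reflected copies of
    the set {f > n}, taken inside a fixed bounded cube X, and the measure of
    that set is at least vol(Q) / 2^d
    ([lebesgue_outer_measure_reflection_cover]). Since f is measurable and
    finite, the measures of these sets tend to 0
    ([outer_measure_decreasing_cvg0]), so this is impossible for large n.

    The measure-theoretic input is that the d-dimensional Lebesgue outer measure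
    is an outer measure, and that a box has outer measure at least its volume
    ([box_volume_le_lebesgue_outer_measure]). *)

Set Implicit Arguments.
Unset Strict Implicit.
Unset Printing Implicit Defensive.

(** * Series and continuity from above of outer measures *)

Lemma nneseries_pairs (R : realType) (F : nat * nat -> \bar R)
    (f : {bij [set: nat] >-> [set: nat * nat]}) :
  (forall p, 0 <= F p)%E ->
  (\sum_(0 <= k <oo) F (f k) = \sum_(0 <= i <oo) \sum_(0 <= j <oo) F (i, j))%E.
Proof.
move=> F0.
rewrite nneseries_esumT; last by [].
rewrite -(@reindex_esum R nat (nat * nat)%type setT setT f F) //.
under eq_eseriesr do rewrite nneseries_esumT //.
rewrite nneseries_esumT; last by move=> n; exact: esum_ge0.
rewrite esum_esum//; congr esum; first by apply/seteqP; split.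
by apply/funext => -[].
Qed.

(** Continuity from above for the trace of [mu] on a set [X] that need not be
    measurable. The layers [F n \ F n.+1] cut [X] into pieces whose measures
    add up, by the Caratheodory condition, to at most [mu X], so their series
    converges; the union of the layers from [n] on contains [X] cut by [F n],
    which is therefore bounded by a tail of that series. *)
Lemma outer_measure_decreasing_cvg0 (R : realType) (T : Type)
    (mu : {outer_measure set T -> \bar R}) (X : set T) (F : (set T)^nat) :
  (mu X < +oo)%E -> (forall n, mu.-caratheodory (F n)) ->
  (forall n, F n.+1 `<=` F n) -> \bigcap_n F n = set0 ->
  (fun n => mu (X `&` F n)) @ \oo --> (0%E : \bar R).
Proof.
move=> muX mF dF F0.
pose D n := X `&` (F n `\` F n.+1).
have muE n : (\sum_(0 <= k < n) mu (D k) + mu (X `&` F n) = mu (X `&` F 0%N))%E.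
  elim: n => [|n IH]; first by rewrite big_nil add0e.
  rewrite big_nat_recr//= -addeA -[RHS]IH; congr (_ + _)%E.
  rewrite [RHS](mF n.+1) addeC; congr (mu _ + mu _)%E.
    by rewrite -setIA (setIidr (dF n)).
  by rewrite /D setDE setIA.
have sumD : (\sum_(0 <= k <oo) mu (D k) < +oo)%E.
  apply: (@le_lt_trans _ _ (mu X)) => //.
  apply: lime_le.
    by apply: is_cvg_nneseries => n _ _; exact: outer_measure_ge0.
  apply: nearW => n; rewrite (@le_trans _ _ (mu (X `&` F 0%N)))//.
    by rewrite -(muE n) leeDl// outer_measure_ge0.
  by apply: (le_outer_measure mu); exact: subIsetl.
have FD n : X `&` F n `<=` \bigcup_(k in ~` `I_n) D k.
  move=> x [Xx Fx].
  (* Some [F m] with [m >= n] misses [x]; the layer of [x] is the last [F k]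
     before the first such [m]. *)
  have [m nm Fm] : exists2 m, (n <= m)%N & ~ F m x.
    apply: contrapT => H.
    suff: (\bigcap_k F k) x by rewrite F0.
    move=> k _; have [nk|/ltnW kn] := leqP n k.
      by apply: contrapT => Fk; apply: H; exists k.
    elim: n kn Fx {H} => [|n IH]; first by rewrite leqn0 => /eqP ->.
    by rewrite leq_eqVlt => /predU1P[->//|kn /dF]; exact: IH.
  elim: m nm Fm => [|m IH nm Fm].
    by rewrite leqn0 => /eqP n0; rewrite n0 in Fx.
  have [Fmx|Fmx] := pselect (F m x); last first.
    apply: IH => //; move: nm; rewrite leq_eqVlt => /predU1P[nm|//].
    by rewrite -nm in Fm.
  have [nm'|mn] := leqP n m; first by exists m => //=; apply/negP; rewrite -leqNgt.
  have e : n = m.+1 by apply/eqP; rewrite eqn_leq nm mn.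
  by rewrite -e in Fm.
apply: (@squeeze_cvge _ _ _ _ (fun=> 0%E) _
    (fun n => (\sum_(n <= k <oo) mu (D k))%E)).
- apply: nearW => n; rewrite outer_measure_ge0/=.
  apply: (le_trans (le_outer_measure mu _ _ (FD n))).
  exact: outer_measure_sigma_subadditive_tail.
- exact: cvg_cst.
- by apply: nneseries_tail_cvg => // k _; exact: outer_measure_ge0.
Qed.

(** * Lebesgue outer measure of boxes and of reflected sets *)

(** One step of the coordinatewise integration that compares volumes: a bound
    by weighted indicators of intervals, integrated over [l, u]. *)
Lemma integrate_interval_cover (R : realType) (l u P : R) (c a b : nat -> R) :
  l <= u -> 0 <= P -> (forall n, 0 <= c n) -> (forall n, a n <= b n) ->
  (forall t, l <= t <= u ->
    (P%:E <= \sum_(0 <= n <oo) (c n * (a n < t < b n)%R%:R)%:E)%E) ->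
  ((P * (u - l))%:E <= \sum_(0 <= n <oo) (c n * (b n - a n))%:E)%E.
Proof.
move=> lu P0 c0 ab cov.
set mu := (@lebesgue_measure R).
have lebE (i : interval R) v w : v <= w -> i = `[v, w] \/ i = `]v, w[ ->
    mu [set` i] = (w - v)%:E.
  rewrite /mu lebesgue_measure_itv => vw [->|->] /=; rewrite lte_fin;
    by move: vw; rewrite le_eqVlt => /predU1P[->|->//]; rewrite ltxx subrr.
have termE n t : ((c n * (a n < t < b n)%R%:R)%:E =
    (c n)%:E * (\1_(`]a n, b n[%classic) t)%:E)%E.
  by rewrite indicE mem_setE in_itv/= EFinM.
have term0 n t : (0 <= (c n)%:E * (\1_(`]a n, b n[%classic) t)%:E)%E.
  by rewrite -termE lee_fin mulr_ge0.
pose g n (t : R) := ((c n)%:E * (\1_(`]a n, b n[%classic) t)%:E)%E.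
have mg n : measurable_fun `[l, u]%classic (g n).
  by apply: measurable_funeM; apply/measurable_EFinP; exact: measurable_indic.
have luE (t : R) : `[l, u]%classic t -> l <= t <= u by rewrite /= in_itv.
have -> : (P * (u - l))%:E = (\int[mu]_(t in `[l, u]%classic) P%:E)%E.
  by rewrite integral_cst// EFinM -(lebE `[l, u] l u lu)//; left.
apply: (@le_trans _ _ (\int[mu]_(t in `[l, u]%classic)
    \sum_(0 <= n <oo) g n t)%E).
  apply: ge0_le_integral => //.
  - by apply: ge0_emeasurable_sum => [k x _ _|k _]; [exact: term0|exact: mg].
  - move=> t /luE/cov/le_trans; apply.
    by under eq_eseriesr do rewrite termE.
rewrite integral_nneseries//; last by move=> n t _; exact: term0.
apply: lee_nneseries => [n _ _|n _].
  by apply: integral_ge0 => t _; exact: term0.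
rewrite ge0_integralZl//; last 2 first.
- by apply/measurable_EFinP; exact: measurable_indic.
- by rewrite lee_fin.
rewrite integral_indic// EFinM lee_wpmul2l ?lee_fin//.
rewrite -(lebE `]a n, b n[ _ _ (ab n)); last by right.
apply: le_measure; last exact: subIsetl.
- by rewrite inE; apply: measurableI.
- by rewrite inE.
Qed.

Section euclidean_outer_measure.
Variables (R : realType) (d : nat).
Implicit Types (A : set 'rV[R]_d) (a b x y : 'rV[R]_d) (S : {set 'I_d}).

Local Notation "mu^*" := (@lebesgue_outer_measure R d).

Lemma box_volume_ge0 a b :
  (forall i, a ord0 i <= b ord0 i) -> 0 <= box_volume a b.
Proof. by move=> ab; apply: prodr_ge0 => i _; rewrite subr_ge0. Qed.

Lemma lebesgue_outer_measure_ge0 A : (0 <= mu^* A)%E.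
Proof.
apply: le_ereal_inf_tmp => _ [a [b [ab _ ->]]].
by apply: nneseries_ge0 => k _ _; rewrite lee_fin box_volume_ge0.
Qed.

Lemma le_lebesgue_outer_measure : {homo mu^* : A B / A `<=` B >-> (A <= B)%E}.
Proof.
move=> A B AB; apply: ereal_inf_le_tmp => _ [a [b [ab Bab ->]]].
by exists a, b; split => //; exact: subset_trans AB Bab.
Qed.

(** Near-optimal covers of the [A n], with errors summing to [e], are merged
    into a single cover through a bijection between nat and its square. *)
Lemma lebesgue_outer_measure_sigma_subadditive : sigma_subadditive mu^*.
Proof.
move=> A.
have [[i ioo]|] := pselect (exists i, mu^* (A i) = +oo%E).
  rewrite (eseries_pinfty _ _ ioo) ?leey// => n _.
  by rewrite -ltNye (lt_le_trans _ (lebesgue_outer_measure_ge0 _)).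
rewrite -forallNE => Aoo.
apply/lee_addgt0Pr => e e0.
have A0 n := lebesgue_outer_measure_ge0 (A n).
apply: (le_trans _ (epsilon_trick _ A0 (ltW e0))).
have /choice[ab abP] n : exists ab : (nat -> 'rV[R]_d) * (nat -> 'rV[R]_d),
    [/\ forall k (i : 'I_d), ab.1 k ord0 i <= ab.2 k ord0 i,
        A n `<=` \bigcup_k open_box (ab.1 k) (ab.2 k) &
        (\sum_(0 <= k <oo) (box_volume (ab.1 k) (ab.2 k))%:E <=
          mu^* (A n) + (e / (2 ^ n.+1)%:R)%:E)%E].
  have en : 0 < e / (2 ^ n.+1)%:R by rewrite divr_gt0// ltr0n expn_gt0.
  have Afin : mu^* (A n) \is a fin_num.
    rewrite ge0_fin_numE ?lebesgue_outer_measure_ge0//.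
    by rewrite ltey; apply/eqP; exact: Aoo.
  have [_ [a [b [ab Aab ->]]] /ltW le] := lb_ereal_inf_adherent en Afin.
  by exists (a, b).
have /card_esym/ppcard_eqP[f] := card_nat2.
pose F p := (box_volume ((ab p.1).1 p.2) ((ab p.1).2 p.2))%:E.
have F0 p : (0 <= F p)%E.
  by have [? _ _] := abP p.1; rewrite lee_fin box_volume_ge0.
apply: (@le_trans _ _ (\sum_(0 <= k <oo) F (f k))%E).
  apply: ereal_inf_lbound.
  exists (fun k => (ab (f k).1).1 (f k).2), (fun k => (ab (f k).1).2 (f k).2).
  split => // [k i|x [n _ Anx]]; first by have [+ _ _] := abP (f k).1; exact.
  have [_ /(_ _ Anx)[m _ xm] _] := abP n.
  by exists (f^-1%FUN (n, m)) => //; rewrite invK ?inE.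
rewrite nneseries_pairs//; apply: lee_nneseries => [n _ _|n _].
  exact: nneseries_ge0.
by have [_ _] := abP n.
Qed.

(** The summands produced by splitting [x j] as [y j + (x j - y j)] in every
    coordinate, the set [S] recording where [y j] is kept. *)
Definition coordinate_reflection S x y : 'rV[R]_d :=
  \row_j (if j \in S then y ord0 j else x ord0 j - y ord0 j).

(** As a function of [y], the map only reflects some coordinates, so it pulls
    boxes back to boxes of the same volume. *)
Lemma le_lebesgue_outer_measure_reflection S x A :
  (mu^* (coordinate_reflection S x @^-1` A) <= mu^* A)%E.
Proof.
apply: ereal_inf_le_tmp => _ [a [b [ab Aab ->]]].
pose a' k : 'rV[R]_d :=
  \row_j (if j \in S then a k ord0 j else x ord0 j - b k ord0 j).
pose b' k : 'rV[R]_d :=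
  \row_j (if j \in S then b k ord0 j else x ord0 j - a k ord0 j).
exists a', b'; split.
- by move=> k i; rewrite !mxE; case: ifP => // _; rewrite lerD2l lerN2.
- move=> y /Aab[k _ yk]; exists k => // i; move: (yk i); rewrite !mxE.
  by case: ifP => // _ /andP[? ?]; apply/andP; split; lra.
- apply: eq_eseriesr => k _; congr EFin; apply: eq_bigr => i _.
  by rewrite !mxE; case: ifP => // _; ring.
Qed.

Definition closed_box a b : set 'rV[R]_d :=
  [set x | forall i : 'I_d, a ord0 i <= x ord0 i <= b ord0 i].

(** The cover says that the indicators of its boxes sum to at least 1 on the
    closed box. An indicator is a product over the coordinates; integrating the
    inequality over one coordinate at a time turns its factors into side
    lengths, without any measure on the product space, and handles a countable
    cover at once, so that no finite subcover has to be extracted. *)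
Lemma box_volume_le_lebesgue_outer_measure a b :
  (forall i, a ord0 i <= b ord0 i) ->
  ((box_volume a b)%:E <= mu^* (closed_box a b))%E.
Proof.
move=> ab; apply: le_ereal_inf_tmp => _ [u [v [uv cov ->]]].
(* Coordinates below [i] have been integrated out, the others are still
   evaluated at [x]. *)
pose c i n x : R := (\prod_(j < d | (j < i)%N) (v n ord0 j - u n ord0 j)) *
  \prod_(j < d | (i <= j)%N) (u n ord0 j < x ord0 j < v n ord0 j)%R%:R.
suff partial i : (i <= d)%N -> forall x, closed_box a b x ->
    ((\prod_(j < d | (j < i)%N) (b ord0 j - a ord0 j))%:E <=
     \sum_(0 <= n <oo) (c i n x)%:E)%E.
  have aab : closed_box a b a by move=> i; rewrite lexx ab.
  have := partial d (leqnn d) a aab.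
  rewrite /box_volume; under eq_bigl do rewrite ltn_ord.
  move=> /le_trans; apply; rewrite le_eqVlt; apply/orP; left; apply/eqP.
  apply: eq_eseriesr => n _; congr EFin; rewrite /c.
  rewrite [X in _ * X]big_pred0 ?mulr1; last by move=> j; rewrite leqNgt ltn_ord.
  by apply: eq_bigl => j; rewrite ltn_ord.
elim: i => [_ x abx|i IH id x abx].
  have [k _ xk] := cov _ abx.
  have c0 n : (0 <= (c 0%N n x)%:E)%E.
    by rewrite lee_fin /c big_pred0// mul1r prodr_ge0.
  apply: (le_trans _ (nneseries_lim_ge k.+1 (fun n _ _ => c0 n))).
  rewrite big_nat_recr//= big_pred0//.
  have -> : c 0%N k x = 1.
    by rewrite /c big_pred0// mul1r big1// => j _; rewrite xk.
  by rewrite leeDr// sume_ge0.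
pose o := Ordinal id.
pose w n : R := (\prod_(j < d | (j < i)%N) (v n ord0 j - u n ord0 j)) *
  \prod_(j < d | (i < j)%N) (u n ord0 j < x ord0 j < v n ord0 j)%R%:R.
have cut (F : 'I_d -> R) :
    \prod_(j < d | (j < i.+1)%N) F j = \prod_(j < d | (j < i)%N) F j * F o.
  rewrite (bigD1 o)//= mulrC; congr (_ * _); apply: eq_bigl => j.
  by rewrite ltnS andbC -val_eqE -ltn_neqAle.
have cut' (F : 'I_d -> R) :
    \prod_(j < d | (i <= j)%N) F j = F o * \prod_(j < d | (i < j)%N) F j.
  rewrite (bigD1 o)//=; congr (_ * _); apply: eq_bigl => j.
  by rewrite andbC -(inj_eq val_inj) eq_sym -ltn_neqAle.
rewrite cut.
have cE n : c i.+1 n x = w n * (v n ord0 o - u n ord0 o).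
  by rewrite /c cut /w mulrAC.
under eq_eseriesr do rewrite cE.
apply: integrate_interval_cover => //.
- by apply: prodr_ge0 => j _; rewrite subr_ge0.
- move=> n; rewrite mulr_ge0//; first by apply: prodr_ge0 => j _; rewrite subr_ge0.
  exact: prodr_ge0.
move=> t t_ab.
have abxt : closed_box a b (row_upd x o t).
  by move=> j; rewrite mxE; case: eqP => [->|_].
apply: le_trans (IH (ltnW id) _ abxt) _.
rewrite le_eqVlt; apply/orP; left; apply/eqP.
apply: eq_eseriesr => n _; congr EFin; rewrite /c cut' mxE eqxx /w -mulrA.
congr (_ * _); rewrite mulrC; congr (_ * _).
apply: eq_bigr => j ij; rewrite mxE; case: eqP => // jo.
by rewrite jo ltnn in ij.
Qed.

End euclidean_outer_measure.

(** * Consequences of componentwise subadditivity *)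

Section componentwise_subadditive.
Variables (R : realType) (d : nat).
Implicit Types (f : 'rV[R]_d -> R).

(** Subadditivity in the coordinate [k] bounds [f] at the current point by the
    sum of its values at two points; the larger value is at least half of the
    sum. Moving to that point, one coordinate after the other, costs a factor 2
    each time. *)
Lemma componentwise_subadditive_reflection f (x y : 'rV[R]_d) :
  componentwise_subadditive f ->
  exists S : {set 'I_d}, f x <= 2 ^+ d * f (coordinate_reflection S x y).
Proof.
move=> fsub.
pose z k (S : {set 'I_d}) : 'rV[R]_d :=
  \row_j (if (j < k)%N then coordinate_reflection S x y ord0 j else x ord0 j).
suff partial k : (k <= d)%N -> exists S : {set 'I_d}, f x <= 2 ^+ k * f (z k S).
  have [S fS] := partial d (leqnn d); exists S.
  suff <- : z d S = coordinate_reflection S x y by [].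
  by apply/rowP => j; rewrite mxE ltn_ord.
elim: k => [_|k IH kd].
  exists finset.set0; rewrite expr0 mul1r.
  suff -> : z 0%N finset.set0 = x by [].
  by apply/rowP => j; rewrite mxE.
have [S fS] := IH (ltnW kd).
pose o := Ordinal kd.
have zE (S' : {set 'I_d}) t :
    (forall j : 'I_d, j != o -> (j \in S') = (j \in S)) ->
    t = (if o \in S' then y ord0 o else x ord0 o - y ord0 o) ->
    row_upd (z k S) o t = z k.+1 S'.
  move=> SS' ->; apply/rowP => j; rewrite !mxE; case: eqVneq => [->|jo].
    by rewrite /= ltnSn.
  rewrite SS'// ltnS [in RHS]leq_eqVlt.
  by rewrite (negPf (jo : val j != k)).
have := fsub o (z k S) (y ord0 o) (x ord0 o - y ord0 o).
rewrite /= (addrC (y ord0 o)) subrK.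
rewrite (zE (o |: S) (y ord0 o)); last 2 first.
- by move=> j /negPf jo; rewrite !inE jo.
- by rewrite !inE eqxx.
rewrite (zE (S :\ o) (x ord0 o - y ord0 o)); last 2 first.
- by move=> j jo; rewrite !inE jo.
- by rewrite !inE eqxx.
rewrite (_ : row_upd _ _ _ = z k S); last first.
  apply/rowP => j; rewrite !mxE; case: eqVneq => [->|//].
  by rewrite /= ltnn.
move=> fzS.
have [le|/ltW le] := leP (f (z k.+1 (o |: S))) (f (z k.+1 (S :\ o))).
- exists (S :\ o); apply: (le_trans fS).
  by rewrite exprSr -mulrA ler_pM2l ?exprn_gt0//; lra.
- exists (o |: S); apply: (le_trans fS).
  by rewrite exprSr -mulrA ler_pM2l ?exprn_gt0//; lra.
Qed.

Definition cube (r : R) : set 'rV[R]_d :=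
  closed_box (const_mx (- r)) (const_mx r).

Lemma cubeP r x : cube r x <-> forall i : 'I_d, - r <= x ord0 i <= r.
Proof. by split=> xr i; have := xr i; rewrite !mxE. Qed.

(** Replacing a coordinate [t] of the argument by 0 raises [f] by at most [B],
    since [f(0) <= f(t) + f(- t)] in that coordinate. After [d] replacements the
    argument is 0. *)
Lemma componentwise_subadditive_lbound f (r B : R) :
  componentwise_subadditive f -> 0 <= r ->
  (forall x, cube r x -> f x <= B) ->
  forall x, cube r x -> f 0 - d%:R * B <= f x.
Proof.
move=> fsub r0 fB x /cubeP xr.
pose z k : 'rV[R]_d := \row_j (if (j < k)%N then 0 else x ord0 j).
suff partial k : (k <= d)%N -> f (z k) - k%:R * B <= f x.
  have <- : z d = 0 by apply/rowP => j; rewrite !mxE ltn_ord.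
  exact: partial.
elim: k => [_|k IH kd].
  rewrite mul0r subr0; suff -> : z 0%N = x by [].
  by apply/rowP => j; rewrite mxE.
apply: le_trans (IH (ltnW kd)).
pose o := Ordinal kd.
have := fsub o (z k) (x ord0 o) (- x ord0 o); rewrite /= subrr.
have -> : row_upd (z k) o 0 = z k.+1.
  apply/rowP => j; rewrite !mxE; case: eqVneq => [->|jo].
    by rewrite /= ltnSn.
  rewrite ltnS [in RHS]leq_eqVlt.
  by rewrite (negPf (jo : val j != k)).
have -> : row_upd (z k) o (x ord0 o) = z k.
  apply/rowP => j; rewrite !mxE; case: eqVneq => [->|//].
  by rewrite /= ltnn.
have /fB : cube r (row_upd (z k) o (- x ord0 o)).
  apply/cubeP => j; rewrite !mxE; case: eqVneq => _.
    by have /andP[? ?] := xr o; apply/andP; split; lra.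
  by case: ifP => _; [rewrite oppr_le0 r0|exact: xr].
rewrite -natr1 mulrDl mul1r; lra.
Qed.

End componentwise_subadditive.

(** * The upper bound on cubes *)

Section positive_dimension.
Variables (R : realType) (d : nat).
Local Notation "mu^*" := (@lebesgue_outer_measure R d.+1).

Lemma lebesgue_outer_measure_open_box (a b : 'rV[R]_d.+1) :
  (forall i, a ord0 i <= b ord0 i) ->
  (mu^* (open_box a b) <= (box_volume a b)%:E)%E.
Proof.
move=> ab; apply: ereal_inf_lbound.
(* All boxes but the first are degenerate: their volume is 0 because there is
   at least one coordinate. *)
exists (fun k => if k == 0%N then a else 0),
  (fun k => if k == 0%N then b else 0).
split => [k i|x abx|]; first by case: ifP.
  by exists 0%N.
rewrite (nneseries_split 0 1) => [|k _]; last first.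
  by rewrite lee_fin box_volume_ge0// => i; case: ifP.
rewrite big_nat1/= eseries0 ?adde0// => -[|k]// _ _.
by rewrite /box_volume/= (bigD1 ord0)//= subrr mul0r.
Qed.

Lemma lebesgue_outer_measure_set0 : mu^* set0 = 0%E.
Proof.
apply/eqP; rewrite eq_le lebesgue_outer_measure_ge0 andbT.
have -> : 0%E = (box_volume (0 : 'rV[R]_d.+1) 0)%:E.
  by rewrite /box_volume (bigD1 ord0)//= subrr mul0r.
apply: le_trans (@lebesgue_outer_measure_open_box 0 0 _) => //.
by apply: le_lebesgue_outer_measure.
Qed.

HB.instance Definition _ := isOuterMeasure.Build R 'rV[R]_d.+1 mu^*
  lebesgue_outer_measure_set0 (@lebesgue_outer_measure_ge0 R d.+1)
  (@le_lebesgue_outer_measure R d.+1)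
  (@lebesgue_outer_measure_sigma_subadditive R d.+1).

Lemma lebesgue_outer_measure_reflection_cover (x : 'rV[R]_d.+1)
    (A E : set 'rV[R]_d.+1) :
  (forall y, A y -> exists S, E (coordinate_reflection S x y)) ->
  (mu^* A <= #|{set 'I_d.+1}|%:R%:E * mu^* E)%E.
Proof.
move=> cov.
pose F i := coordinate_reflection
  (nth finset.set0 (enum {set 'I_d.+1}) i) x @^-1` E.
apply: (@le_trans _ _ (mu^* (\big[setU/set0]_(i < #|{set 'I_d.+1}|) F i))).
  apply: le_lebesgue_outer_measure => y /cov[S ES]; rewrite -bigcup_mkord.
  exists (enum_rank S) => /=; first exact: ltn_ord.
  by rewrite /F /= -enum_val_nth enum_rankK.
apply: (le_trans (outer_measure_subadditive mu^* _ _)).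
apply: (@le_trans _ _ (\sum_(i < #|{set 'I_d.+1}|) mu^* E)%E).
  by apply: lee_sum => i _; exact: le_lebesgue_outer_measure_reflection.
by rewrite mule_natl sumr_const card_ord.
Qed.

(** If [f x] exceeds [2 ^ d * n] for some [x] in the cube, then every [y] of the
    cube has a reflection at which [f] exceeds [n]; so the part of a larger cube
    on which [f > n] has measure at least a fixed positive number. This fails
    for large [n] since [f] takes finite values. *)
Lemma measurable_componentwise_subadditive_ubound
    (f : 'rV[R]_d.+1 -> R) (r : R) :
  lebesgue_measurable_fun f -> componentwise_subadditive f -> 0 < r ->
  exists B, forall x, cube r x -> f x <= B.
Proof.
move=> mf fsub r0.
pose F (n : nat) := f @^-1` `]n%:R, +oo[%classic.
(* [x - y] lies in the closed cube of half-side [2 * r], so [3 * r] leaves room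
   for an open one. *)
pose X := open_box (const_mx (- (3 * r))) (const_mx (3 * r) : 'rV[R]_d.+1).
have FE n x : F n x <-> n%:R < f x by rewrite /F /= in_itv/= andbT.
have XF0 : (fun n => mu^* (X `&` F n)) @ \oo --> 0%E.
  apply: outer_measure_decreasing_cvg0.
  - apply: (le_lt_trans (lebesgue_outer_measure_open_box _)); last exact: ltry.
    by move=> i; rewrite !mxE; lra.
  - by move=> n; apply: mf; exact: measurable_itv.
  - by move=> n x /FE nx; apply/FE; apply: lt_trans nx; rewrite ltr_nat.
  - apply/seteqP; split => // x /(_ (Num.bound `|f x|) I) /FE bfx.
    have := lt_le_trans bfx (ler_norm (f x)).
    by rewrite ltNge ltW// archi_boundP.
pose v := box_volume (const_mx (- r)) (const_mx r : 'rV[R]_d.+1).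
have v0 : 0 < v by apply: prodr_gt0 => i _; rewrite !mxE; lra.
pose N : R := #|{set 'I_d.+1}|%:R.
have N0 : 0 < N by rewrite ltr0n; apply/card_gt0P; exists finset.set0.
have vN : (0%E < (v / N)%:E)%E by rewrite lte_fin divr_gt0.
have [n _ /(_ n (leqnn n))/= small] := XF0 _ (open_ereal_lt' vN).
exists (2 ^+ d.+1 * n%:R) => x /cubeP xr; rewrite leNgt; apply/negP => fx.
have vQ : (v%:E <= mu^* (cube r))%E.
  by apply: box_volume_le_lebesgue_outer_measure => i; rewrite !mxE; lra.
have /(le_trans vQ) : (mu^* (cube r) <= N%:E * mu^* (X `&` F n))%E.
  apply: (@lebesgue_outer_measure_reflection_cover x) => y /cubeP yr.
  have [S fS] := componentwise_subadditive_reflection x y fsub.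
  exists S; split.
    move=> i; have := yr i; have := xr i; rewrite !mxE.
    by move=> /andP[? ?] /andP[? ?]; apply/andP; split; case: ifP => _; lra.
  apply/FE; rewrite -(@ltr_pM2l _ (2 ^+ d.+1)) ?exprn_gt0//.
  exact: lt_le_trans fS.
move: small (lebesgue_outer_measure_ge0 (X `&` F n)).
case: (mu^* _) => [m| |]//; rewrite lte_fin ltr_pdivlMr// => mN _.
by rewrite -EFinM lee_fin leNgt mulrC mN.
Qed.

End positive_dimension.

(** * Boundedness on compact sets *)

Theorem theorem4p7 (R : realType) (d : nat) (hd : (1 <= d)%N)
    (f : 'rV[R]_d -> R)
    (hmeas : lebesgue_measurable_fun f)
    (hsub : componentwise_subadditive f)
    (K : set 'rV[R]_d) (hK : compact K) :
  has_ubound (f @` K) /\ has_lbound (f @` K).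
Proof.
case: d hd f hmeas hsub K hK => // d _ f mf fsub K /compact_bounded Kbounded.
have [r r0 Kr] : exists2 r, 0 < r & K `<=` cube r.
  have [M [_ KM]] := Kbounded.
  exists (Num.max M 0 + 1); first by rewrite ltr_pwDr// le_max lexx orbT.
  have MM : M < Num.max M 0 + 1 by rewrite ltr_pwDr// le_max lexx.
  move=> x Kx; apply/cubeP => i; rewrite -ler_norml (le_trans _ (KM _ MM x Kx))//.
  rewrite {2}/Num.norm/= mx_normrE.
  exact: (@le_bigmax _ _ _ 0 (fun ij => `|x ij.1 ij.2|) (ord0, i)).
have [B fB] := measurable_componentwise_subadditive_ubound mf fsub r0.
split.
  by exists B => _ [x /Kr xr <-]; exact: fB.
exists (f 0 - d.+1%:R * B) => _ [x /Kr xr <-].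
exact: (componentwise_subadditive_lbound fsub (ltW r0) fB).
Qed.
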